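(* Let $k$ be a field of characteristic zero, let $B$ be a standard graded artinian $k$-algebra, let $d\geq 1$, and set $A=B\otimes_k k[x]/(x^d)$, where $x$ is a variable that does not appear in $B$. Let $i,t\geq 0$ be integers. If $\overline{\ell}$ is a general linear form in $B$ and $\ell=\overline{\ell}+x$ is a general linear form in $A$, then $$\cdot \ell^t:A_i\to A_{i+t}$$ has full rank if and only if the maps $$\cdot\overline{\ell}^{\,2q+t-(d-1)}:B_{i-q}\to B_{i+q+t-(d-1)},$$ where $q$ goes from $\max\{0,d-t\}$ to $d-1$, are either all injective or all surjective.
   Context: A standard graded artinian $k$-algebra $B$ is a finite-dimensional quotient of a polynomial ring $k[x_1,\dots,x_n]$ (all variables of degree $1$) by a homogeneous ideal; $B_j$ denotes its degree $j$ component, and $B_j=0$ for $j<0$ or $j$ larger than the socle degree. $A=B\otimes_k k[x]/(x^d)$ is standard graded with $x$ in degree $1$, so $A_j=\bigoplus_{r=0}^{d-1}x^rB_{j-r}$. A linear map has full rank if it is injective or surjective. ''General linear form of $B$'' means a linear form in a suitable nonempty Zariski-open subset of $B_1$; after rescaling the variable $x$, a general linear form of $A$ has the form $\ell=\overline{\ell}+x$ with $\overline{\ell}$ a general linear form of $B$. *)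

(* Defs.v *)
From HB Require Import structures.
From mathcomp Require Import all_boot all_order all_algebra all_field.
From mathcomp Require Import mpoly.
Set Implicit Arguments.
Unset Strict Implicit.
Unset Printing Implicit Defensive.
Import GRing.Theory.
Local Open Scope ring_scope.

(* The map considered is the map D -> E induced by f, for f sending D to E. *)
Section FullRank.
Variables (T1 T2 : Type) (D : {pred T1}) (E : {pred T2}) (f : T1 -> T2).

Definition injective_on := {in D &, injective f}.
Definition surjective_onto := forall w, w \in E -> exists2 u, u \in D & f u = w.
Definition full_rank := injective_on \/ surjective_onto.

End FullRank.

Section Zariski.
Variables (k : fieldType) (vT : vectType k) (V : {vspace vT}).

(* U is a union of nonvanishing loci, in V, of polynomials in the coordinates
   of a basis of V; the notion does not depend on the basis. *)
Definition zariski_open (U : vT -> Prop) :=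
  (forall v, U v -> v \in V) /\
  exists S : {mpoly k[\dim V]} -> Prop, forall v, v \in V ->
    (U v <-> exists2 p, S p & p.@[fun i => coord (vbasis V) i v] != 0).

Definition for_general (P : vT -> Prop) :=
  exists U : vT -> Prop,
    [/\ zariski_open U, exists v, U v & forall v, U v -> P v].

End Zariski.

(* The algebra {mpoly k[nvars]} / ker proj, where ker proj is a homogeneous
   ideal: each homogeneous component of an element of it belongs to it. As
   finite-dimensional algebras over k are nontrivial in the library, this ideal
   is proper. *)
Record std_graded_artinian (k : fieldType) := StdGradedArtinian {
  sga_falg : falgType k;
  sga_nvars : nat;
  sga_proj : {lrmorphism {mpoly k[sga_nvars]} -> sga_falg};
  sga_proj_surj : forall b, exists f, sga_proj f = b;
  sga_ker_homog :
    forall f, sga_proj f = 0 -> forall j, sga_proj (pihomog mdeg j f) = 0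
}.

(* The library has no structure of commutative finite-dimensional algebras, so
   the carrier is an alias with both sets of instances. *)
Definition sga_sort (k : fieldType) (B : std_graded_artinian k) : Type :=
  sga_falg B.
Coercion sga_sort : std_graded_artinian >-> Sortclass.

HB.instance Definition _ (k : fieldType) (B : std_graded_artinian k) :=
  Falgebra.on (sga_sort B).

Fact sga_mulC (k : fieldType) (B : std_graded_artinian k) :
  commutative (@GRing.mul B).
Proof.
move=> a b; have [f <-] := sga_proj_surj a; have [g <-] := sga_proj_surj b.
by rewrite -!(rmorphM (sga_proj B)) mulrC.
Qed.

HB.instance Definition _ (k : fieldType) (B : std_graded_artinian k) :=
  GRing.PzRing_hasCommutativeMul.Build (sga_sort B) (@sga_mulC k B).

(* The tensor product of B and k[x]/(x^d), realised as B[x]/(x^d), where d > 0;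
   its elements are represented by polynomials over B of degree < d. *)
Notation tensor_trunc B d :=
  {poly %/ ('X^d : {poly (sga_sort B)})} (only parsing).

Section Graded.
Variables (k : fieldType) (B : std_graded_artinian k).

(* The degree j component B_j, spanned by the images of the monomials of
   degree j; it is 0 for j < 0. *)
Definition grade (j : int) : {vspace B} :=
  match j with
  | Posz m =>
      (\sum_(x : 'X_{1..(sga_nvars B) < m.+1} | mdeg x == m)
          <[sga_proj B 'X_[x] : B]>)%VS
  | Negz _ => 0%VS
  end.

(* The direct sum of the x^r B_{j-r} for r < d. *)
Definition tensor_grade (d : nat) (j : int) : {pred tensor_trunc B d} :=
  [pred a : tensor_trunc B d |
    [forall r : 'I_d, (a : {poly B})`_r \in grade (j - (r : nat)%:Z)]].

(* l + x *)
Definition lift_form (d : nat) (l : B) : tensor_trunc B d :=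
  qpolyC 'X^d l + qpolyX 'X^d.

End Graded.

Arguments grade {k} B j.
Arguments tensor_grade {k} B d j.

(* Main.v *)
Require Import Defs.
From HB Require Import structures.
From mathcomp Require Import all_boot all_order all_algebra all_field.
From mathcomp Require Import mpoly.
From mathcomp Require Import zify ring.
Set Implicit Arguments.
Unset Strict Implicit.
Unset Printing Implicit Defensive.
Import GRing.Theory.
Local Open Scope ring_scope.

(* Write y for the action of l. Multiplication by (x + y)^t on the free
   k[y]-module k[y][x]/(x^d) has a graded Smith normal form, obtained from Pade
   approximants of (1 + X)^t. For q < d <= q + t there is F of degree exactly q
   with (1 + X)^t F congruent mod X^d to some G of degree exactly d-1-q; for
   q + t < d one takes F = X^q and G = (1 + X)^t X^q. The homogenizations f_q of
   the F's and g_r of the G's are both triangular with nonzero constants on the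
   diagonal, so they remain bases after replacing y by any l in B_1, and
   (x + l)^t f_q = l^e g_r, with (r, e) = (d-1-q, 2q+t-(d-1)) or (q+t, 0). Hence
   the map A_i -> A_{i+t} is injective (surjective) iff all the maps l^e on
   B_{i-q} are; those with e = 0 are bijective. *)

(** * The permutation of degrees in the Smith normal form *)

Definition smith_index (d t q : nat) : nat :=
  if (q + t < d)%N then (q + t)%N else (d.-1 - q)%N.

(** The branch [q + t < d] of [smith_index] has as image the r with t <= r < d, the other branch the
    r < min(t, d); hence the test [t <= r]. *)
Definition smith_index_inv (d t r : nat) : nat :=
  if (t <= r)%N then (r - t)%N else (d.-1 - r)%N.

Lemma smith_index_lt d t q : (q < d)%N -> (smith_index d t q < d)%N.
Proof. by rewrite /smith_index; case: ifP; lia. Qed.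

Lemma smith_index_inv_lt d t r : (r < d)%N -> (smith_index_inv d t r < d)%N.
Proof. by rewrite /smith_index_inv; case: ifP; lia. Qed.

Lemma smith_indexK d t q :
  (q < d)%N -> smith_index_inv d t (smith_index d t q) = q.
Proof. by rewrite /smith_index_inv /smith_index; do 2!case: ifP; lia. Qed.

Lemma smith_index_invK d t r :
  (r < d)%N -> smith_index d t (smith_index_inv d t r) = r.
Proof. by rewrite /smith_index_inv /smith_index; do 2!case: ifP; lia. Qed.

Lemma smith_index_le d t q : (q < d)%N -> (smith_index d t q <= t + q)%N.
Proof. by rewrite /smith_index; case: ifP; lia. Qed.

(** * Pade approximants of (1 + X)^t *)

Section Pade.
Variable k : fieldType.
Implicit Types F G : {poly k}.

Lemma size_Xadd1_exp t F :
  F != 0 -> size (('X + 1) ^+ t * F) = (t + size F)%N.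
Proof.
move=> F0; elim: t => [|t IH]; first by rewrite mul1r.
rewrite exprS -mulrA size_monicM -?size_poly_gt0 ?IH.
- by rewrite -[1]opprK -polyCN size_XsubC.
- by rewrite -[1]opprK -polyCN monicXsubC.
- by rewrite addn_gt0 size_poly_gt0 F0 orbT.
Qed.

(** F has q + 1 free coefficients, and the vanishing of the coefficients of (1 + X)^t F in degrees
    d-q to d-1 imposes q linear conditions. *)
Lemma pade_exists t d q : (q < d)%N ->
  exists F, [/\ F != 0, (size F <= q.+1)%N &
    (size (take_poly d (('X + 1) ^+ t * F)) <= d - q)%N].
Proof.
move=> lt_qd.
pose M := \matrix_(i < q.+1, j < q)
  (('X + 1 : {poly k}) ^+ t * 'X^i)`_(d - q + j).
have : kermx M != 0.
  rewrite -mxrank_eq0 mxrank_ker subn_eq0 -ltnNge ltnS.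
  exact: rank_leq_col.
case/rowV0Pn => v /sub_kermxP vM v0.
exists (rVpoly v); split.
- by apply: contraNneq v0 => /(congr1 (@poly_rV _ q.+1)); rewrite rVpolyK linear0 => ->.
- exact: size_poly.
apply/leq_sizeP => r le_r; rewrite coef_take_poly; case: ifP => // lt_rd.
have lt_r : (r - (d - q) < q)%N by lia.
have /matrixP/(_ 0 (Ordinal lt_r)) := vM; rewrite !mxE => E.
rewrite /rVpoly poly_def mulr_sumr coef_sum -[RHS]E.
apply: eq_bigr => i _; rewrite insubT // => lt_i.
rewrite -scalerAr coefZ mxE /= subnKC //; congr (_ * _).
by congr (v _ _); apply: val_inj.
Qed.

Lemma coefM_top (R : nzSemiRingType) (p q : {poly R}) a b :
  (size p <= a.+1)%N -> (size q <= b.+1)%N -> (p * q)`_(a + b) = p`_a * q`_b.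
Proof.
move=> sp sq; rewrite coefM.
have lt_a : (a < (a + b).+1)%N by rewrite ltnS leq_addr.
rewrite (bigD1 (Ordinal lt_a)) //= addKn big1 ?addr0 // => j /eqP ne_j.
have {ne_j} : (j : nat) <> a by move=> e; apply: ne_j; apply: val_inj.
have [lt_ja|lt_aj|//] := ltngtP (j : nat) a => _.
  by rewrite [q`_ _]nth_default ?mulr0 //; apply: leq_trans sq _; lia.
by rewrite [p`_ _]nth_default ?mul0r //; apply: leq_trans sp _.
Qed.

Lemma size_polyM_bound (R : nzSemiRingType) (p q : {poly R}) a b e :
  (size p <= a.+1)%N -> (size q <= b.+1)%N -> (a + b < e)%N -> (size (p * q)%R <= e)%N.
Proof.
move=> sp sq abe; have := size_polyMleq p q.
move: (size p) (size q) (size (p * q)%R) sp sq => u v w; lia.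
Qed.

(** The derivation (1 + X) d/dX multiplies the leading coefficient in degree m by m and has (1 +
    X)^t as an eigenvector with eigenvalue t. *)
Let euler F := ('X + 1) * F^`().

Lemma size_euler F m : (size F <= m.+1)%N -> (size (euler F) <= m.+1)%N.
Proof.
move=> sF; apply/leq_sizeP => r lt_mr.
rewrite /euler mulrDl mul1r coefD coefXM !coef_deriv !nth_default
  ?mul0rn ?if_same ?addr0 //.
  by apply: leq_trans sF _; lia.
by case: r lt_mr => // r lt_mr; apply: leq_trans sF _.
Qed.

Lemma coef_euler F m : (size F <= m.+1)%N -> (euler F)`_m = F`_m *+ m.
Proof.
move=> sF; rewrite /euler mulrDl mul1r coefD coefXM !coef_deriv.
rewrite (nth_default 0 sF) mul0rn addr0.
by case: m {sF}.
Qed.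

Lemma euler_Xadd1_exp t F :
  euler (('X + 1) ^+ t * F) = ('X + 1) ^+ t * (t%:R * F + euler F).
Proof.
rewrite /euler derivM; case: t => [|t].
  by rewrite !derivE; ring.
by rewrite deriv_exp !derivE addr0 mul1r /= !exprS -mulr_natl; ring.
Qed.

(* Differentiating (1 + X)^t F = G mod X^d shows that X^(d-1) divides
   G (t F + (1 + X) F') - (1 + X) F G', whose coefficient of degree
   deg F + deg G is (t + deg F - deg G) lead(F) lead(G). *)
Lemma pade_deg (char_k : [pchar k] =i pred0) t d F :
  F != 0 -> (size F <= d)%N ->
  let G := take_poly d (('X + 1) ^+ t * F) in
  (size G < t + size F)%N -> (d < size F + size G)%N.
Proof.
move=> F0 sF G sG; rewrite ltnNge; apply/negP => sFG.
set H := drop_poly d (('X + 1) ^+ t * F).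
have EG : ('X + 1) ^+ t * F = G + H * 'X^d by rewrite poly_take_drop.
(* If G = 0, then X^d divides (1 + X)^t F, hence F, as X is coprime to 1 + X; this contradicts deg F
   < d. *)
have G0 : G != 0.
  apply: contraNneq F0 => G0; move: EG; rewrite G0 add0r => EG.
  have : 'X^d %| ('X + 1) ^+ t * F by rewrite EG dvdp_mulIr.
  rewrite Gauss_dvdpr; last first.
    rewrite coprimep_sym; apply: coprimep_expl; apply: coprimep_expr.
    by rewrite coprimepX rootE !hornerE oner_neq0.
  move=> dvd; apply/eqP; apply: contraTeq dvd => F0.
  by apply: contraL sF => /(dvdp_leq F0); rewrite size_polyXn ltnNge.
move: F0 G0; rewrite -!size_poly_gt0 => F0 G0.
case: d => [|e] in G H sF sG sFG EG F0 G0 *; first lia.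
(* The Wronskian of G and (1 + X)^t F for [euler], with the factor (1 + X)^t removed. It would
   vanish with G + H X^d in place of G, so only terms from H X^d remain, and [euler] lowers their
   order to d-1 = e at worst. *)
pose W := G * (t%:R * F + euler F) - F * euler G.
have WX : W = 'X^e * (('X + 1) * F * (H^`() * 'X + e.+1%:R * H)
                - H * 'X * (t%:R * F + euler F)).
  have E : F * euler (G + H * 'X^(e.+1)) = (G + H * 'X^(e.+1)) * (t%:R * F + euler F).
    by rewrite -EG euler_Xadd1_exp; ring.
  have EH : euler (G + H * 'X^(e.+1)) =
      euler G + ('X + 1) * (H^`() * 'X * 'X^e + e.+1%:R * H * 'X^e).
    by rewrite /euler derivD derivM derivXn -mulr_natl exprS /=; ring.
  rewrite EH exprS in E; rewrite /W.
  set S := _ + euler F in E *.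
  have -> : G * S = (G + H * ('X * 'X^e)) * S - H * 'X * 'X^e * S by ring.
  by rewrite -E; ring.
have [m sm] : exists m, size F = m.+1 by exists (size F).-1; rewrite prednK.
have [n sn] : exists n, size G = n.+1 by exists (size G).-1; rewrite prednK.
have sE : (size (t%:R * F + euler F)%R <= m.+1)%N.
  rewrite (leq_trans (size_polyD _ _)) // geq_max size_euler ?sm // andbT.
  by rewrite mulr_natl -scaler_nat (leq_trans (size_scale_leq _ _)) ?sm.
(* Since deg F + deg G <= d-2 < e, W has degree below e while X^e divides it, so W = 0. *)
have sW : (size W <= e)%N.
  rewrite (leq_trans (size_polyD _ _)) // geq_max size_polyN.
  rewrite (size_polyM_bound (eq_leq sn) sE); last by move: sFG; rewrite sm sn; lia.
  rewrite (size_polyM_bound (eq_leq sm) (size_euler (eq_leq sn))) //.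
  by move: sFG; rewrite sm sn; lia.
have W0 : W = 0.
  apply/eqP; apply: contraLR sW => W0; rewrite -ltnNge.
  rewrite -[X in (X <= _)%N](size_polyXn k); apply: dvdp_leq => //.
  by rewrite WX dvdp_mulIl.
have : W`_(n + m) = 0 by rewrite W0 coef0.
rewrite coefB coefM_top ?sn // addnC coefM_top ?sm ?size_euler ?sn //.
rewrite coefD mulr_natl coefMn !coef_euler ?sm ?sn //.
have lcF : F`_m != 0 by rewrite -[m]/(m.+1.-1) -sm -lead_coefE lead_coef_eq0
    -size_poly_gt0.
have lcG : G`_n != 0 by rewrite -[n]/(n.+1.-1) -sn -lead_coefE lead_coef_eq0
    -size_poly_gt0.
have -> (a c : k) : a * (c *+ t + c *+ m) - c * (a *+ n) = a * c * ((t + m)%:R - n%:R).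
  by rewrite -[c *+ t]mulr_natl -[c *+ m]mulr_natl -[a *+ n]mulr_natl natrD; ring.
move/eqP; rewrite !mulf_eq0 (negPf lcF) (negPf lcG) /=.
rewrite subr_eq0 => /eqP e_tmn.
(* The bound on [size G] says n < t + m, so t + m - n is a positive integer, nonzero in
   characteristic zero. *)
have le_n : (n <= t + m)%N by move: sG; rewrite sm sn; lia.
have /eqP : (t + m - n)%N%:R = 0 :> k by rewrite natrB // e_tmn subrr.
rewrite ((pcharf0P k).1 char_k); move: sG; rewrite sm sn; lia.
Qed.

(** When q + t >= d, the sizes of F and G are at most q + 1 and d - q, and [pade_deg], applicable
    since d - q <= t, makes their sum exceed d: both bounds are attained. *)
Lemma pade (char_k : [pchar k] =i pred0) t d q : (q < d)%N ->
  exists F : {poly k}, size F = q.+1 /\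
    size (take_poly d (('X + 1) ^+ t * F)) = (smith_index d t q).+1.
Proof.
move=> lt_qd; rewrite /smith_index; case: ifP => [lt_qtd|ge_qtd].
  have sX : size (('X + 1) ^+ t * 'X^q : {poly k}) = (q + t).+1.
    by rewrite size_Xadd1_exp -?size_poly_gt0 size_polyXn // addnS addnC.
  by exists 'X^q; rewrite size_polyXn take_poly_id sX.
have [F [F0 sF sG]] := pade_exists t lt_qd; exists F.
have := pade_deg char_k (t := t) F0 (leq_trans sF lt_qd).
move=> /(_ ltac:(move: F0; rewrite -size_poly_gt0; lia)).
move: F0; rewrite -size_poly_gt0; lia.
Qed.

End Pade.

(** * Homogenization at a linear form and triangular bases *)

Section Homogenize.
Variables (k : fieldType) (B : std_graded_artinian k).
Implicit Types (l : B) (i j : int) (n q r d t : nat) (F : {poly k}).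

Lemma grade1M l (b : B) j : l \in grade B 1 -> b \in grade B j -> l * b \in grade B (j + 1).
Proof.
case: j => m; last by move=> _; rewrite memv0 => /eqP ->; rewrite mulr0 mem0v.
rewrite -[Posz m + 1]/(Posz (m + 1)) addn1 => lB bB.
have [u lE ->] := memv_sumP lB; have [v bE ->] := memv_sumP bB.
rewrite mulr_suml; apply: memv_suml => x dx; rewrite mulr_sumr.
apply: memv_suml => y dy.
have /vlineP[a ->] := lE x dx; have /vlineP[c ->] := bE y dy.
rewrite -scalerAl -scalerAr !memvZ // -(rmorphM (sga_proj B)) -mpolyXD.
have dxy : mdeg (x + y)%MM = m.+1 by rewrite mdegD (eqP dx) (eqP dy).
have lt_xy : (mdeg (x + y)%MM < m.+2)%N by rewrite dxy.
by apply/(subvP (sumv_sup (BMultinom lt_xy) _ (subvv _))); rewrite /= ?dxy ?memv_line.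
Qed.

Lemma gradeXM l (b : B) j n :
  l \in grade B 1 -> b \in grade B j -> l ^+ n * b \in grade B (j + n%:Z).
Proof.
move=> lB bB; elim: n => [|n IH]; first by rewrite mul1r addr0.
by rewrite exprS -mulrA -addn1 PoszD addrA grade1M.
Qed.

(** The form y^n F(X/y) with l substituted for y; this makes sense for l nilpotent. *)
Definition homogenize l n F : {poly B} := \poly_(r < n.+1) (F`_r *: l ^+ (n - r)).

Lemma homogenize_Xadd1 l n F : (size F <= n.+1)%N ->
  (l%:P + 'X) * homogenize l n F = homogenize l n.+1 (('X + 1) * F).
Proof.
move=> sF; apply/polyP => r.
rewrite !mulrDl mul1r coefD coefCM coefXM !coef_poly coefD coefXM.
case: r => [|r] /=; first by rewrite addr0 add0r !subn0 -scalerAr exprS.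
rewrite !ltnS subSS; have [lt_rn|lt_nr|->] := ltngtP r n.
- by rewrite -scalerAr -exprS subnSK // -scalerDl addrC.
- by rewrite mulr0 addr0.
- by rewrite mulr0 add0r (nth_default 0 sF) addr0.
Qed.

Lemma homogenize_Xadd1_exp l n t F : F != 0 -> (size F <= n.+1)%N ->
  (l%:P + 'X) ^+ t * homogenize l n F = homogenize l (t + n) (('X + 1) ^+ t * F).
Proof.
move=> F0 sF; elim: t => [|t IH]; first by rewrite !mul1r.
by rewrite !exprS -!mulrA IH homogenize_Xadd1 // size_Xadd1_exp // -addnS leq_add2l.
Qed.

Section Triangular.
Variables (l : B) (n : nat) (F : nat -> {poly k}).
Hypothesis sizeF : forall q, (q < n)%N -> size (F q) = q.+1.

(** The polynomial with coordinates b in the family f_q. The top coefficient of f_q is the constant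
    [lead_coef (F q)], free of l, so coordinates can be solved for from the top degree down. *)
Definition triangular (m : nat) (b : nat -> B) : {poly B} :=
  \sum_(q < m) b q *: homogenize l q (F q).

Lemma size_triangular m (b : nat -> B) : (size (triangular m b) <= m)%N.
Proof.
apply: (leq_trans (size_sum _ _ _)); apply/bigmax_leqP => q _.
apply: leq_trans (size_scale_leq _ _) _; apply: leq_trans (size_poly _ _) _.
exact: ltn_ord.
Qed.

Lemma coef_triangular_top m (b : nat -> B) : (m < n)%N ->
  (triangular m.+1 b)`_m = b m * (lead_coef (F m))%:A.
Proof.
move=> lt_mn; rewrite /triangular big_ord_recr coefD -/(triangular m b).
rewrite nth_default ?size_triangular // add0r coefZ coef_poly ltnSn subnn.
by rewrite lead_coefE sizeF.
Qed.

Lemma lead_coef_sizeF m : (m < n)%N -> lead_coef (F m) != 0.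
Proof. by move=> lt_mn; rewrite lead_coef_eq0 -size_poly_gt0 sizeF. Qed.

Lemma triangular_inj m (b : nat -> B) : (m <= n)%N -> triangular m b = 0 ->
  forall q, (q < m)%N -> b q = 0.
Proof.
elim: m => // m IH lt_mn b0.
have bm : b m = 0.
  have := coef_triangular_top b lt_mn; rewrite b0 coef0 -scalerAr mulr1.
  by move/esym/eqP; rewrite scaler_eq0 (negPf (lead_coef_sizeF lt_mn)) => /eqP.
move: b0; rewrite /triangular big_ord_recr /= bm scale0r addr0 => b0 q.
rewrite ltnS leq_eqVlt => /orP[/eqP -> //|]; exact: IH (ltnW lt_mn) b0 _.
Qed.

Hypothesis lB : l \in grade B 1.

Lemma triangular_grade i m (b : nat -> B) :
  (forall q, (q < m)%N -> b q \in grade B (i - q%:Z)) ->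
  forall r, (triangular m b)`_r \in grade B (i - r%:Z).
Proof.
move=> bB r; rewrite coef_sum; apply: memv_suml => q _.
rewrite coefZ coef_poly; case: ltnP => [le_rq|_]; last by rewrite mulr0 mem0v.
rewrite -scalerAr memvZ // mulrC.
have -> : i - r%:Z = i - q%:Z + (q - r)%N%:Z by move: le_rq; lia.
exact: gradeXM (bB _ (ltn_ord q)).
Qed.

Lemma triangular_surj i m (p : {poly B}) : (m <= n)%N -> (size p <= m)%N ->
  (forall r, (r < m)%N -> p`_r \in grade B (i - r%:Z)) ->
  exists2 b : nat -> B, forall q, (q < m)%N -> b q \in grade B (i - q%:Z)
                       & p = triangular m b.
Proof.
elim: m p => [|m IH] p le_mn sp pB.
  exists (fun=> 0) => //; rewrite /triangular big_ord0.
  by apply/eqP; rewrite -size_poly_leq0.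
have lc0 := lead_coef_sizeF le_mn.
pose bm := (lead_coef (F m))^-1 *: p`_m.
have bmB : bm \in grade B (i - m%:Z) by rewrite memvZ ?pB.
(* A single multiple of f_m cancelling the top coefficient of p; as a [triangular] sum it inherits
   the size, grading and coefficient lemmas. *)
pose top := triangular m.+1 (fun q => if q == m then bm else 0).
have topE : top = bm *: homogenize l m (F m).
  rewrite /top /triangular big_ord_recr /= eqxx big1 ?add0r // => q _.
  by rewrite ltn_eqF ?scale0r.
have topB r : top`_r \in grade B (i - r%:Z).
  apply: triangular_grade => q _; case: eqP => [->|_] //; exact: mem0v.
have sp' : (size (p - top)%R <= m)%N.
  apply/leq_sizeP => r; rewrite leq_eqVlt => /orP[/eqP <-|lt_mr]; rewrite coefB.
    rewrite coef_triangular_top // eqxx -scalerAr mulr1 scalerA divff //.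
    by rewrite scale1r subrr.
  by rewrite !nth_default ?subr0 // ?(leq_trans sp) // (leq_trans (size_triangular _ _)).
have [r lt_rm|b bB bE] := IH _ (ltnW le_mn) sp'.
  by rewrite coefB rpredB ?pB // ltnW.
exists (fun q => if q == m then bm else b q) => [q|].
  by rewrite ltnS leq_eqVlt; case: eqP => [-> //|_ /= /bB].
rewrite -[LHS](subrK top) bE topE /triangular big_ord_recr /= eqxx; congr (_ + _).
by apply: eq_bigr => q _; rewrite ltn_eqF.
Qed.

End Triangular.
End Homogenize.

Lemma bounded_choice (T : Type) (x0 : T) (P : nat -> T -> Prop) d :
  (forall q, (q < d)%N -> exists x, P q x) ->
  exists f, forall q, (q < d)%N -> P q (f q).
Proof.
elim: d => [|d IH] exP; first by exists (fun=> x0).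
have [q lt_qd|f fP] := IH; first by apply: exP; apply: ltnW.
have [x xP] := exP d (ltnSn d).
exists (fun q => if q == d then x else f q) => q.
by rewrite ltnS leq_eqVlt; case: eqP => [-> //|_ /= /fP].
Qed.

(** For d = 0 the quotient construction replaces the modulus 1 by X; hence the condition on d. *)
Lemma in_qpolyXnE (R : nzRingType) d (p : {poly R}) :
  (0 < d)%N -> in_qpoly 'X^d p = take_poly d p :> {poly R}.
Proof. by move=> d0; rewrite Pdiv.RingMonic.take_poly_rmodp /= mk_monic_Xn prednK. Qed.

(** * Diagonalization of multiplication by the power of l + x *)

Section Smith.
Variables (k : fieldType) (char_k : [pchar k] =i pred0).
Variables (B : std_graded_artinian k) (d : nat) (d_gt0 : (0 < d)%N) (t : nat).
Implicit Types (H : nat -> {poly k}) (b : nat -> B) (i : int).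

(** Indexing the truncations by their degrees makes the G's a triangular family too. *)
Lemma pade_family : exists F G : nat -> {poly k},
  [/\ forall q, (q < d)%N -> size (F q) = q.+1,
      forall r, (r < d)%N -> size (G r) = r.+1 &
      forall q, (q < d)%N ->
        G (smith_index d t q) = take_poly d (('X + 1) ^+ t * F q)].
Proof.
have [F FP] := bounded_choice 0 (fun q => pade char_k t (d := d) (q := q)).
exists F, (fun r => take_poly d (('X + 1) ^+ t * F (smith_index_inv d t r))).
split=> [q /FP[] //|r lt_rd|q lt_qd]; last by rewrite smith_indexK.
by have [_ ->] := FP _ (smith_index_inv_lt t lt_rd); rewrite smith_index_invK.
Qed.

Variables F G : nat -> {poly k}.
Hypothesis sizeF : forall q, (q < d)%N -> size (F q) = q.+1.
Hypothesis sizeG : forall r, (r < d)%N -> size (G r) = r.+1.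
Hypothesis FG : forall q, (q < d)%N ->
  G (smith_index d t q) = take_poly d (('X + 1) ^+ t * F q).
Variable l : B.
Hypothesis lB : l \in grade B 1.

Definition trunc_triangular (H : nat -> {poly k}) (b : nat -> B) :
  tensor_trunc B d := in_qpoly 'X^d (triangular l H d b).

Lemma trunc_triangularE H b : trunc_triangular H b = triangular l H d b :> {poly B}.
Proof. by rewrite in_qpolyXnE // take_poly_id // size_triangular. Qed.

Lemma eq_trunc_triangular H b b' :
  (forall q, (q < d)%N -> b q = b' q) -> trunc_triangular H b = trunc_triangular H b'.
Proof.
move=> eq_b; rewrite /trunc_triangular /triangular; congr in_qpoly.
by apply: eq_bigr => q _; rewrite eq_b.
Qed.

Lemma trunc_triangular_inj H b b' : (forall q, (q < d)%N -> size (H q) = q.+1) ->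
  trunc_triangular H b = trunc_triangular H b' -> forall q, (q < d)%N -> b q = b' q.
Proof.
move=> sizeH /(congr1 (fun a : tensor_trunc B d => a : {poly B})).
rewrite !trunc_triangularE => eq_b q lt_qd.
apply/eqP; rewrite -subr_eq0; apply/eqP.
apply: (triangular_inj (l := l) sizeH (b := fun q => b q - b' q) (leqnn d)) => //.
rewrite /triangular (eq_bigr _ (fun q _ => scalerBl _ _ _)) sumrB.
by apply/eqP; rewrite subr_eq0; apply/eqP.
Qed.

Lemma trunc_triangular_grade H i b :
  (forall q, (q < d)%N -> b q \in grade B (i - q%:Z)) ->
  trunc_triangular H b \in tensor_grade B d i.
Proof.
by move=> bB; apply/forallP => r; rewrite trunc_triangularE triangular_grade.
Qed.

Lemma trunc_triangular_surj H i a : (forall q, (q < d)%N -> size (H q) = q.+1) ->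
  a \in tensor_grade B d i ->
  exists2 b : nat -> B, forall q, (q < d)%N -> b q \in grade B (i - q%:Z)
                      & a = trunc_triangular H b.
Proof.
move=> sizeH /forallP aB.
have sa : (size (a : {poly B}) <= d)%N.
  by apply: leq_trans (size_npoly a) _; rewrite mk_monic_Xn size_polyXn prednK.
have [r lt_rd|b bB aE] := triangular_surj sizeH lB (leqnn d) sa (i := i).
  exact: (aB (Ordinal lt_rd)).
by exists b => //; apply: val_inj; exact: etrans aE (esym (trunc_triangularE H b)).
Qed.

Lemma lift_formE : lift_form d l = in_qpoly 'X^d (l%:P + 'X).
Proof.
rewrite in_qpolyD; congr (_ + _); apply: val_inj.
apply/esym; apply: in_qpoly_small; apply: leq_ltn_trans (size_mk_monic_gt1 _).
by rewrite size_polyC leq_b1.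
Qed.

(** (1 + X)^t F_q is homogenized in degree t + q, but its truncation G has degree
    [smith_index d t q]; the gap is the exponent of l. *)
Definition smith_exp q := (t + q - smith_index d t q)%N.

Lemma lift_form_exp_triangular b :
  lift_form d l ^+ t * trunc_triangular F b =
  trunc_triangular G (fun r =>
    l ^+ smith_exp (smith_index_inv d t r) * b (smith_index_inv d t r)).
Proof.
rewrite lift_formE -(rmorphXn (in_qpoly _)) -rmorphM.
apply: val_inj; apply: etrans (in_qpolyXnE _ d_gt0) (esym _).
apply: etrans (in_qpolyXnE _ d_gt0) (esym _).
apply/polyP => r; rewrite !coef_take_poly; case: ifP => // lt_rd.
rewrite mulr_sumr !coef_sum.
rewrite [RHS](reindex_onto (fun q : 'I_d => Ordinal (smith_index_lt t (ltn_ord q)))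
  (fun r : 'I_d => Ordinal (smith_index_inv_lt t (ltn_ord r)))) /=; last first.
  by move=> r' _; apply: val_inj; rewrite /= smith_index_invK.
apply: eq_big => q.
  by rewrite /= -val_eqE /= smith_indexK ?eqxx.
move=> _; rewrite smith_indexK // -scalerAr homogenize_Xadd1_exp; first last.
- by rewrite sizeF.
- by rewrite -size_poly_gt0 sizeF.
rewrite !coefZ !coef_poly !ltnS.
have GE : (('X + 1) ^+ t * F q)`_r = (G (smith_index d t q))`_r.
  by rewrite FG // coef_take_poly lt_rd.
have le_s := smith_index_le t (ltn_ord q).
(* With s the degree of G, l^(t+q-r) splits as l^(t+q-s) l^(s-r) for r <= s; for s < r < d the
   coefficient of G is 0. *)
case: (leqP r (smith_index d t q)) => [le_rs|lt_sr].
  rewrite (leq_trans le_rs le_s) GE -!scalerAr mulrAC -exprD mulrC.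
  by congr (_ *: (_ ^+ _ * _)); rewrite /smith_exp; move: le_s le_rs; lia.
rewrite GE nth_default ?scale0r ?if_same ?mulr0 // sizeG //.
exact: smith_index_lt.
Qed.

Let mul_lift (a : tensor_trunc B d) := lift_form d l ^+ t * a.

Lemma lift_form_exp_injP i :
  injective_on (tensor_grade B d i) mul_lift <->
  (forall q, (q < d)%N ->
     injective_on (grade B (i - q%:Z)) (fun x : B => l ^+ smith_exp q * x)).
Proof.
split=> [inj q lt_qd x y xB yB /= eq_xy | inj u v].
  (* Coordinates concentrated at q isolate one diagonal map. *)
  pose single (x : B) (q' : nat) : B := if q' == q then x else 0.
  have bB z : z \in grade B (i - q%:Z) ->
      trunc_triangular F (single z) \in tensor_grade B d i.
    move=> zB; apply: trunc_triangular_grade => q' _.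
    by rewrite /single; case: eqP => [->|] //; rewrite mem0v.
  have : trunc_triangular F (single x) = trunc_triangular F (single y).
    apply: inj; rewrite ?bB // /mul_lift !lift_form_exp_triangular.
    apply: eq_trunc_triangular => r _; rewrite /single.
    by case: eqP => [->|_].
  by move/(trunc_triangular_inj sizeF)/(_ q lt_qd); rewrite /single eqxx.
case/(trunc_triangular_surj sizeF) => b bB -> /(trunc_triangular_surj sizeF)[b' bB' ->].
rewrite /mul_lift !lift_form_exp_triangular => /(trunc_triangular_inj sizeG) eq_bb'.
apply: eq_trunc_triangular => q lt_qd; apply: (inj q) => //=; rewrite ?bB ?bB' //.
by have := eq_bb' _ (smith_index_lt t lt_qd); rewrite smith_indexK.
Qed.

Lemma lift_form_exp_surjP i :
  surjective_onto (tensor_grade B d i) (tensor_grade B d (i + t%:Z)) mul_lift <->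
  (forall q, (q < d)%N ->
     surjective_onto (grade B (i - q%:Z)) (grade B (i + t%:Z - (smith_index d t q)%:Z))
       (fun x : B => l ^+ smith_exp q * x)).
Proof.
split=> [surj q lt_qd w wB | surj w].
  pose c r : B := if r == smith_index d t q then w else 0.
  have [|u /(trunc_triangular_surj sizeF)[b bB ->]] := surj (trunc_triangular G c).
    apply: trunc_triangular_grade => r _.
    by rewrite /c; case: eqP => [->|] //; rewrite mem0v.
  rewrite /mul_lift lift_form_exp_triangular => /(trunc_triangular_inj sizeG).
  move=> /(_ _ (smith_index_lt t lt_qd)); rewrite smith_indexK // /c eqxx => <-.
  by exists (b q); rewrite ?bB.
case/(trunc_triangular_surj sizeG) => c cB ->.
(* Preimages are chosen coordinate by coordinate, then assembled in the basis of the f_q. *)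
have [q lt_qd|b bP] := @bounded_choice B 0 (fun q x =>
    x \in grade B (i - q%:Z) /\ l ^+ smith_exp q * x = c (smith_index d t q)) d.
  have [x xB xE] := surj q lt_qd _ (cB _ (smith_index_lt t lt_qd)).
  by exists x.
exists (trunc_triangular F b).
  by apply: trunc_triangular_grade => q /bP[].
rewrite /mul_lift lift_form_exp_triangular; apply: eq_trunc_triangular => r lt_rd.
by have [_ ->] := bP _ (smith_index_inv_lt t lt_rd); rewrite smith_index_invK.
Qed.

End Smith.

(** * Full rank in terms of the diagonal maps *)

Lemma for_general_all (k : fieldType) (vT : vectType k) (V : {vspace vT})
  (P : vT -> Prop) : (forall v, v \in V -> P v) -> for_general V P.
Proof.
(* The open set is all of V, the nonvanishing locus of 1. *)
move=> VP; exists (fun v => v \in V); split=> //; last by exists 0; apply: mem0v.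
split=> //; exists (fun p => p = 1) => v vV; split=> // _.
by exists 1; rewrite // rmorph1 oner_neq0.
Qed.

Unset Implicit Arguments.

Theorem theorem1p1 (k : fieldType) (char_k : [pchar k] =i pred0)
    (B : std_graded_artinian k) (d : nat) (d_ge1 : (1 <= d)%N) (i t : nat) :
  for_general (grade B 1) (fun l : B =>
    full_rank (tensor_grade B d i%:Z) (tensor_grade B d (i%:Z + t%:Z))
              (fun a => lift_form d l ^+ t * a)
    <->
    (forall q : nat, (maxn 0 (d - t) <= q <= d - 1)%N ->
       injective_on (grade B (i%:Z - q%:Z))
                    (fun b => l ^+ (2 * q + t - (d - 1)) * b))
    \/
    (forall q : nat, (maxn 0 (d - t) <= q <= d - 1)%N ->
       surjective_onto (grade B (i%:Z - q%:Z))
                       (grade B (i%:Z + q%:Z + t%:Z - (d%:Z - 1)))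
                       (fun b => l ^+ (2 * q + t - (d - 1)) * b))).
Proof.
apply: for_general_all => l lB.
have [F [G [sizeF sizeG FG]]] := pade_family char_k d t.
(* For these q the diagonal map is the identity of B_{i-q}, compatible with both alternatives. *)
have small q : (q + t < d)%N -> smith_index d t q = (q + t)%N /\ smith_exp d t q = 0%N.
  by rewrite /smith_exp /smith_index => lt_qtd; rewrite lt_qtd; lia.
(* Here q + t >= d, so the natural subtraction in the exponent is exact. *)
have large q : (maxn 0 (d - t) <= q <= d - 1)%N ->
    [/\ (q < d)%N, smith_exp d t q = (2 * q + t - (d - 1))%N &
      i%:Z + t%:Z - (smith_index d t q)%:Z = i%:Z + q%:Z + t%:Z - (d%:Z - 1)].
  rewrite /smith_exp /smith_index => /andP[q_ge q_le]; rewrite max0n in q_ge.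
  have lt_qd : (q < d)%N by lia.
  have -> : (q + t < d)%N = false by lia.
  by split=> //; lia.
have dich q : (q < d)%N -> (q + t < d)%N \/ (maxn 0 (d - t) <= q <= d - 1)%N by lia.
have injP := lift_form_exp_injP d_ge1 sizeF sizeG FG lB i.
have surjP := lift_form_exp_surjP d_ge1 sizeF sizeG FG lB i.
rewrite /full_rank; split=> [] [h|h]; [left|right|left|right].
- by move=> q /large[lt_qd <- _]; move: q lt_qd; apply/injP.
- by move=> q /large[lt_qd <- <-]; move: q lt_qd; apply/surjP.
- apply/injP => q lt_qd; have [/small[_ ->]|q_range] := dich q lt_qd.
    by move=> x y _ _ /=; rewrite !mul1r.
  by have [_ -> _] := large q q_range; apply: h.
- apply/surjP => q lt_qd; have [/small[-> ->]|q_range] := dich q lt_qd.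
    move=> w; have -> : i%:Z + t%:Z - (q + t)%N%:Z = i%:Z - q%:Z by lia.
    by exists w; rewrite ?mul1r.
  by have [_ -> ->] := large q q_range; apply: h.
Qed.
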